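(* In the two-bus setting of the context, there exists a nonempty open subset $\mathcal U=\mathcal U_\epsilon\times\mathcal U_\mu\subset\mathcal D_\epsilon\times\mathbb{R}^4$ and a unique $C^1$ function $f:\mathcal U_\mu\to\mathbb{R}^2$ such that $(0,0)\in\mathcal U$ (the zero vector of $\mathbb{R}^2\times\mathbb{R}^4$), $f(0)=0$, and $E(f(\mu),\mu)=0$ for all $\mu\in\mathcal U_\mu$. That is, for each sufficiently small $\mu$ there exists a unique $\epsilon=f(\mu)$ such that $$\frac{-k_\mu\gamma_P}{1-k_2^--\epsilon_2}+\frac{\gamma_P}{1-k_2^-}+\rho(1+k_2^-+\epsilon_2)+\tilde\rho=\epsilon_1,$$ $$\frac{-k_\mu\gamma_Q}{1-k_2^--\epsilon_2}+(1-k_2^-)+\tilde\rho(k_1^-+\epsilon_1)-\sqrt{1-(k_1^-+\epsilon_1)^2}=\epsilon_2;$$ consequently, the set $\mathcal A_\epsilon^-=\{(\psi,x)\in\mathbb{R}^2:|\psi|\le k_1^-+\epsilon_1,\ |x|\le k_2^-+\epsilon_2\}$ contains a power flow solution of the two-bus system.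
   Context: Two-bus system. Bus 2 is the generator (slack) bus with fixed voltage magnitude $V_2>0$ and bus 1 is the load bus with active and reactive injections $\bar P_1,Q_1$. The branch has series susceptance $b>0$, series conductance $g$, shunt susceptance $b_c$, and a transformer with tap ratio $t=\bar t+1$ and phase shift $\theta_{\mathrm s}$. The perturbation vector is $\mu=(g,b_c,\bar t,\theta_{\mathrm s})\in\mathbb{R}^4$. Define $$\tilde g=\frac{g\cos\theta_{\mathrm s}-b\sin\theta_{\mathrm s}}{\bar t+1},\quad \tilde b=\frac{b\cos\theta_{\mathrm s}+g\sin\theta_{\mathrm s}}{\bar t+1},\quad \hat b=b-\frac{b_c}{2},\quad \rho=\frac{g}{\hat b},\quad \tilde\rho=\frac{\tilde g}{\tilde b},\quad k_\mu=\frac{b\hat b}{\tilde b^2}.$$ The constants $\rho,\tilde\rho$ quantify the $R/X$ ratio of the branch (realistically $\rho\ge0$ and $\tilde\rho\ge0$). Loading margins: $\gamma_P=\bar P_1/(bV_2^2)$, $\gamma_Q=Q_1/(bV_2^2)$, with standing assumption $0<4\gamma_P^2-4\gamma_Q<1$; the load is inductive ($\gamma_Q\le0$) and the generator injects strictly positive active power ($\gamma_P<0$). Constants: $k_2^-=1-\sqrt{\tfrac12+\gamma_Q+\sqrt{\tfrac14+\gamma_Q-\gamma_P^2}}$ and $k_1^-=-\gamma_P/(1-k_2^-)$. The numbers $\epsilon=(\epsilon_1,\epsilon_2)$ are nonnegative, and $\mathcal D_\epsilon\subset[0,1-k_1^-)\times[0,1-k_2^-)\subset\mathbb{R}^2$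 is an open set. The map $E=(E_1,E_2):\mathcal D_\epsilon\times\mathbb{R}^4\to\mathbb{R}^2$ is $$E_1(\epsilon,\mu)=\frac{-k_\mu\gamma_P}{1-k_2^--\epsilon_2}+\frac{\gamma_P}{1-k_2^-}+\rho(1+k_2^-+\epsilon_2)+\tilde\rho-\epsilon_1,$$ $$E_2(\epsilon,\mu)=\frac{-k_\mu\gamma_Q}{1-k_2^--\epsilon_2}+(1-k_2^-)+\tilde\rho(k_1^-+\epsilon_1)-\sqrt{1-(k_1^-+\epsilon_1)^2}-\epsilon_2.$$ The iteration map $F_\mu$ sends $(\psi,x)$ to $(\psi^+,x^+)$, where $$\psi^+=\frac{-k_\mu\gamma_P}{x+1}+\rho(x+1)-\tilde\rho\sqrt{1-\psi^2},\qquad x^+=\frac{k_\mu\gamma_Q}{x+1}-\tilde\rho\,\psi^++\sqrt{1-(\psi^+)^2}-1.$$ Here $\psi$ is the sine of the branch phase difference and $x=v-1$, where $v=V_1/V_1^\circ$ is the normalized load voltage magnitude with $V_1^\circ=(\tilde b/\hat b)V_2$. A power flow solution of the two-bus system is a fixed point of $F_\mu$.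
   Formalization: D_ε is any open set containing 0 with -1-k_1^- < ε_1 < 1-k_1^- and ε_2 < 1-k_2^- (ε may be negative, since no open subset of the stated box contains 0); the power flow conclusion is claimed only for μ with ρ ≥ 0 and ρ̃ ≥ 0, as it fails e.g. for small g<0 with b_c, t̄, θ_s zero. *)

(* Defs.v *)
From HB Require Import structures.
From mathcomp Require Import all_boot all_order all_algebra.
From mathcomp Require Import all_classical all_reals all_analysis.

Set Implicit Arguments.
Unset Strict Implicit.
Unset Printing Implicit Defensive.

Import Order.TTheory GRing.Theory Num.Theory.
Import numFieldNormedType.Exports.

Local Open Scope classical_set_scope.
Local Open Scope ring_scope.

(* Continuous differentiability through the library's Jacobian matrix.  It is
   meant for open U: jacobian f is required to be continuous at each point of U
   with respect to the full topology, not the subspace topology of U. *)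
Definition C1_on (R : realType) (n m : nat) (U : set 'rV[R]_n.+1)
    (f : 'rV[R]_n.+1 -> 'rV[R]_m.+1) : Prop :=
  forall x, U x -> differentiable f x /\ {for x, continuous (jacobian f)}.

Section TwoBus.
Context {R : realType}.

(* Normalised injections P1 / (b V2^2), Q1 / (b V2^2). *)
Definition loading_margin (b V2 s : R) : R := s / (b * V2 ^+ 2).

(* The perturbation vector is mu = (g, b_c, tbar, theta_s). *)
Definition pert_g (mu : 'rV[R]_4) : R := mu 0 0.
Definition pert_bc (mu : 'rV[R]_4) : R := mu 0 1.
Definition pert_tbar (mu : 'rV[R]_4) : R := mu 0 2.
Definition pert_theta (mu : 'rV[R]_4) : R := mu 0 3.

Definition g_tilde (b : R) (mu : 'rV[R]_4) : R :=
  (pert_g mu * cos (pert_theta mu) - b * sin (pert_theta mu))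
    / (pert_tbar mu + 1).
Definition b_tilde (b : R) (mu : 'rV[R]_4) : R :=
  (b * cos (pert_theta mu) + pert_g mu * sin (pert_theta mu))
    / (pert_tbar mu + 1).
Definition b_hat (b : R) (mu : 'rV[R]_4) : R := b - pert_bc mu / 2.
Definition rho (b : R) (mu : 'rV[R]_4) : R := pert_g mu / b_hat b mu.
Definition rho_tilde (b : R) (mu : 'rV[R]_4) : R :=
  g_tilde b mu / b_tilde b mu.
Definition k_pert (b : R) (mu : 'rV[R]_4) : R :=
  b * b_hat b mu / b_tilde b mu ^+ 2.

Definition k2_minus (gP gQ : R) : R :=
  1 - Num.sqrt (1 / 2 + gQ + Num.sqrt (1 / 4 + gQ - gP ^+ 2)).
Definition k1_minus (gP gQ : R) : R := - gP / (1 - k2_minus gP gQ).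

Definition E1 (b gP gQ : R) (eps : 'rV[R]_2) (mu : 'rV[R]_4) : R :=
  let k2 := k2_minus gP gQ in
  - k_pert b mu * gP / (1 - k2 - eps 0 1) + gP / (1 - k2)
    + rho b mu * (1 + k2 + eps 0 1) + rho_tilde b mu - eps 0 0.

Definition E2 (b gP gQ : R) (eps : 'rV[R]_2) (mu : 'rV[R]_4) : R :=
  let k1 := k1_minus gP gQ in
  let k2 := k2_minus gP gQ in
  - k_pert b mu * gQ / (1 - k2 - eps 0 1) + (1 - k2)
    + rho_tilde b mu * (k1 + eps 0 0)
    - Num.sqrt (1 - (k1 + eps 0 0) ^+ 2) - eps 0 1.

Definition E (b gP gQ : R) (eps : 'rV[R]_2) (mu : 'rV[R]_4) : 'rV[R]_2 :=
  \row_(i < 2) (if i == 0 then E1 b gP gQ eps mu else E2 b gP gQ eps mu).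

Definition flow_iter (b gP gQ : R) (mu : 'rV[R]_4) (p : R * R) : R * R :=
  let psi := p.1 in
  let x := p.2 in
  let psi' := - k_pert b mu * gP / (x + 1) + rho b mu * (x + 1)
              - rho_tilde b mu * Num.sqrt (1 - psi ^+ 2) in
  let x' := k_pert b mu * gQ / (x + 1) - rho_tilde b mu * psi'
            + Num.sqrt (1 - psi' ^+ 2) - 1 in
  (psi', x').

Definition power_flow_solution (b gP gQ : R) (mu : 'rV[R]_4) (p : R * R) : Prop :=
  flow_iter b gP gQ mu p = p.

Definition A_minus (gP gQ : R) (eps : 'rV[R]_2) : set (R * R) :=
  [set p | `|p.1| <= k1_minus gP gQ + eps 0 0 /\
           `|p.2| <= k2_minus gP gQ + eps 0 1].

(* The natural domain of E( . , mu): the square root has a positive radicand and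
   the denominator is positive.  It extends the box
   [0, 1 - k1) x [0, 1 - k2) to negative eps, because no subset of that box is
   a neighbourhood of 0 in the plane. *)
Definition E_domain (gP gQ : R) : set 'rV[R]_2 :=
  [set eps | - 1 - k1_minus gP gQ < eps 0 0 < 1 - k1_minus gP gQ /\
             eps 0 1 < 1 - k2_minus gP gQ].

Definition implicit_solution (b gP gQ : R) (D : set 'rV[R]_2)
    (Umu : set 'rV[R]_4) (f : 'rV[R]_4 -> 'rV[R]_2) : Prop :=
  [/\ C1_on Umu f,
      f 0 = 0,
      (forall mu, Umu mu -> D (f mu)) &
      (forall mu, Umu mu -> E b gP gQ (f mu) mu = 0)].

End TwoBus.

(* Main.v *)
Require Import Defs.
From HB Require Import structures.
From mathcomp Require Import all_boot all_order all_algebra.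
From mathcomp Require Import all_classical all_reals all_analysis.
From mathcomp Require Import ring lra.

Set Implicit Arguments.
Unset Strict Implicit.
Unset Printing Implicit Defensive.

Import Order.TTheory GRing.Theory Num.Theory.
Import numFieldNormedType.Exports.

Local Open Scope classical_set_scope.
Local Open Scope ring_scope.

(* Solving the first equation for [eps1] turns the system [E = 0] into one scalar
   equation in [eps2], whose derivative at the origin is
   [(v^4 - gP^2 - gQ^2) / (v^2 (v^2 - gQ))] with [v = 1 - k2]; this is positive
   because [v^2] is the larger root of a quadratic whose roots have product
   [gP^2 + gQ^2].  A scalar implicit function theorem, proved by monotonicity and
   the intermediate value theorem, then yields [f].  It gives uniqueness for
   [|eps2| <= r] but places the root in [|eps2| < r], so a competing solution
   with [h 0 = 0] cannot leave this range along a segment, by continuity.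
   For the power flow solution no fixed point theorem is needed: the load voltage
   is an explicit monotone function of [psi], and the remaining equation changes
   sign between [0] and [k1 + eps1]. *)

(** * C1 calculus for scalar functions on a normed space *)

Lemma near_continuous_for (T U : topologicalType) (f g : T -> U) (x : T) :
  (\forall y \near x, f y = g y) -> {for x, continuous g} ->
  {for x, continuous f}.
Proof.
move=> fg cg; rewrite /prop_for /continuous_at (nbhs_singleton fg).
by apply: cvg_trans cg; apply: near_eq_cvg; near=> y; apply/esym; near: y.
Unshelve. all: by end_near. Qed.

Section C1_calculus.
Context {R : realType} {V : normedModType R}.
Implicit Types (f g : V -> R) (p : V).

(** Continuity of the differential is asked direction by direction, without an operator norm; on row
    vectors this amounts to continuity of the Jacobian entries. Differentiability is asked on a
    neighbourhood so that the differentiation rules can be applied near [p]. *)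
Definition C1_at f p : Prop :=
  (\forall q \near p, differentiable f q) /\
  forall v, {for p, continuous (fun q => 'd f q v)}.

Lemma C1_at_differentiable f p : C1_at f p -> differentiable f p.
Proof. by case=> /nbhs_singleton. Qed.

Lemma C1_at_continuous f p : C1_at f p -> {for p, continuous f}.
Proof. by move=> /C1_at_differentiable/differentiable_continuous. Qed.

Lemma C1_at_cst (a : R) p : C1_at (fun=> a) p.
Proof.
split=> [|v]; first by near=> q; exact: differentiable_cst.
apply: (@near_continuous_for _ _ _ (fun=> 0)); last exact: cst_continuous.
by near=> q; rewrite (diff_cst a q).
Unshelve. all: by end_near. Qed.

Lemma C1_at_linear f p : linear f -> continuous f -> C1_at f p.
Proof.
move=> linf cf.
pose fL : {linear V -> R} := HB.pack f (GRing.isLinear.Build _ _ _ _ f linf).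
have cfL : continuous fL by exact: cf.
split=> [|v]; first by near=> q; exact: (@linear_differentiable _ _ _ fL q cfL).
apply: (@near_continuous_for _ _ _ (fun=> f v)); last exact: cst_continuous.
near=> q.
have df : 'd f q = f :> (V -> R) := @diff_lin _ _ _ fL q cfL.
by rewrite df.
Unshelve. all: by end_near. Qed.

Lemma C1_at_add f g p :
  C1_at f p -> C1_at g p -> C1_at (fun q => f q + g q) p.
Proof.
move=> [df cf] [dg cg]; split=> [|v].
  by near=> q; apply: differentiableD; near: q.
apply: (@near_continuous_for _ _ _ (fun q => 'd f q v + 'd g q v)).
  by near=> q; rewrite diffD//; near: q.
exact: (continuousD (cf v) (cg v)).
Unshelve. all: by end_near. Qed.

Lemma C1_at_opp f p : C1_at f p -> C1_at (fun q => - f q) p.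
Proof.
move=> [df cf]; split=> [|v].
  by near=> q; apply: differentiableN; near: q.
apply: (@near_continuous_for _ _ _ (fun q => - 'd f q v)).
  by near=> q; rewrite diffN//; near: q.
exact: (continuousN (cf v)).
Unshelve. all: by end_near. Qed.

Lemma C1_at_mul f g p :
  C1_at f p -> C1_at g p -> C1_at (fun q => f q * g q) p.
Proof.
move=> Cf Cg; have fc := C1_at_continuous Cf; have gc := C1_at_continuous Cg.
case: Cf Cg => [df cf] [dg cg]; split=> [|v].
  by near=> q; apply: differentiableM; near: q.
apply: (@near_continuous_for _ _ _ (fun q => f q * 'd g q v + g q * 'd f q v)).
  by near=> q; rewrite diffM//; near: q.
exact: (continuousD (continuousM fc (cg v)) (continuousM gc (cf v))).
Unshelve. all: by end_near. Qed.

(** Continuity of [f] pulls the neighbourhood of [f p] where [h] is derivable back to one of [p], on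
    which the chain rule reads ['d f q v * dh (f q)]. *)
Lemma C1_at_comp f (h dh : R -> R) p :
  (\forall y \near f p, is_derive (y : R) (1 : R) h (dh y)) ->
  {for f p, continuous dh} -> C1_at f p -> C1_at (fun q => h (f q)) p.
Proof.
move=> dhP dhc Cf; have fc := C1_at_continuous Cf; case: Cf => df cf.
have dhfP : \forall q \near p, is_derive (f q) (1 : R) h (dh (f q)) := fc _ dhP.
split=> [|v].
  near=> q; apply: (@differentiable_comp _ _ _ _ f h); first by near: q.
  have hq : is_derive (f q) (1 : R) h (dh (f q)) by near: q.
  by apply/derivable1_diffP; exact: ex_derive.
apply: (@near_continuous_for _ _ _ (fun q => 'd f q v * dh (f q))).
  near=> q; have hq : is_derive (f q) (1 : R) h (dh (f q)) by near: q.
  have dq : derivable h (f q) 1 by exact: ex_derive.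
  rewrite (@diff_comp _ _ _ _ f h) /=; [|by near: q|exact/derivable1_diffP].
  by rewrite deriv1E// derive1E derive_val.
apply: (continuousM (cf v)).
exact: (@continuous_comp _ _ _ f dh).
Unshelve. all: by end_near. Qed.

Lemma C1_at_sin f p : C1_at f p -> C1_at (fun q => sin (f q)) p.
Proof.
apply: (@C1_at_comp f (@sin R) (@cos R)); last exact: continuous_cos.
by near=> y; exact: is_derive_sin.
Unshelve. all: by end_near. Qed.

Lemma C1_at_cos f p : C1_at f p -> C1_at (fun q => cos (f q)) p.
Proof.
apply: (@C1_at_comp f (@cos R) (fun x => - sin x)).
  by near=> y; exact: is_derive_cos.
apply: continuousN; exact: continuous_sin.
Unshelve. all: by end_near. Qed.

Lemma C1_at_inv f p : f p != 0 -> C1_at f p -> C1_at (fun q => (f q)^-1) p.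
Proof.
move=> fp0; apply: (@C1_at_comp f (@GRing.inv R) (fun x => - (x ^+ 2)^-1)).
  near=> y; have y0 : y != 0 by near: y; exact: (cvgr_neq0 (f p) cvg_id fp0).
  have -> : - (y ^+ 2)^-1 = - y ^- 2 *: (1 : R) by rewrite /GRing.scale/= mulr1.
  exact: is_deriveV.
apply: continuousN; apply: continuousV; first by rewrite expf_neq0.
exact: exprn_continuous.
Unshelve. all: by end_near. Qed.

Lemma C1_at_sqrt f p : 0 < f p -> C1_at f p -> C1_at (fun q => Num.sqrt (f q)) p.
Proof.
move=> fp0; apply: (@C1_at_comp f (@Num.sqrt R) (fun x => (2 * Num.sqrt x)^-1)).
  near=> y; have y0 : 0 < y by near: y; apply: lt_nbhsr.
  exact: is_derive1_sqrt.
apply: continuousV; first by rewrite mulf_neq0 ?pnatr_eq0// gt_eqF ?sqrtr_gt0.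
by apply: continuousM; [exact: cst_continuous|exact: sqrt_continuous].
Unshelve. all: by end_near. Qed.

End C1_calculus.

(** * A scalar implicit function theorem *)

Section implicit_function.
Context {R : realType} {V : normedModType R}.

Lemma differentiable_small_increment (U W : normedModType R) (f : U -> W) x :
  differentiable f x -> forall e, 0 < e ->
  \forall h \near 0, `|f (h + x) - f x - 'd f x h| <= e * `|h|.
Proof.
move=> /diff_locally/eqaddoP dfx e e0; move: (dfx e e0).
by apply: filterS => h /=; rewrite opprD addrA.
Qed.

(** The epsilon form of differentiability for a linear candidate, which uniqueness of the
    differential identifies with ['d f x]. *)
Lemma small_increment_differentiable (U W : normedModType R) (f : U -> W)
    (df : {linear U -> W}) x :
  continuous df ->
  (forall e, 0 < e -> \forall h \near 0, `|f (h + x) - f x - df h| <= e * `|h|) ->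
  differentiable f x /\ 'd f x = df :> (U -> W).
Proof.
move=> cdf small.
have E : f \o shift x = cst (f x) + df +o_ 0 id.
  apply/eqaddoP => e e0; move: (small e e0).
  by apply: filterS => h /=; rewrite opprD addrA.
have dE := diff_unique cdf E; split=> //.
by apply/diff_locallyP; rewrite dE.
Qed.

Lemma cvg_to_pair (T : Type) (F : set_system T) (U W : topologicalType)
    (f : T -> U) (g : T -> W) (u : U) (w : W) : Filter F ->
  f @ F --> u -> g @ F --> w -> (f t, g t) @[t --> F] --> (u, w).
Proof. by move=> FF fu gw; exact: (cvg_pair fu gw). Qed.

(** Chain rule along [t |-> (t, x)], whose differential sends [s] to [(s, 0)]. *)
Lemma is_derive_partial1 (H : R * V -> R) y x :
  differentiable H (y, x) ->
  is_derive y (1 : R) (fun t => H (t, x)) ('d H (y, x) (1, 0)).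
Proof.
move=> dH.
have dp : differentiable (fun t : R => (t, x)) y by apply: differentiable_pair.
have dHp : differentiable (fun t => H (t, x)) y.
  exact: (@differentiable_comp _ _ _ _ (fun t : R => (t, x)) H).
split; first exact/derivable1_diffP.
rewrite deriveE// (@diff_comp _ _ _ _ (fun t : R => (t, x)) H)//=.
rewrite (@diff_pair _ _ _ _ id (cst x))//=.
by rewrite diff_cst diff_val.
Qed.

(** The chain rule on [H (f x', x') = 0] dictates the formula. Continuity of [f] at [x] suffices,
    because the nonzero partial derivative [a] turns the expansion of [H] into a linear bound on the
    increment of [f]. *)
Lemma implicit_diff (H : R * V -> R) (f : V -> R) x :
  {for x, continuous f} -> differentiable H (f x, x) ->
  'd H (f x, x) (1, 0) != 0 -> (\forall x' \near x, H (f x', x') = 0) ->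
  differentiable f x /\
  forall v, 'd f x v = - 'd H (f x, x) (0, v) / 'd H (f x, x) (1, 0).
Proof.
move=> cf dH; set p := (f x, x); set a := 'd H p (1, 0) => a0 H0.
have cdH : continuous ('d H p) by exact: diff_continuous.
have dHE s h : 'd H p (s, h) = s * a + 'd H p (0, h).
  have -> : (s, h) = s *: (1, 0) + (0, h) :> R * V.
    by apply: injective_projections; rewrite /= ?scaler0 ?add0r// addr0 /GRing.scale /= mulr1.
  by rewrite linearP.
pose B v := - 'd H p (0, v) / a.
have linB : linear B.
  move=> k u v; rewrite /B.
  have -> : (0, k *: u + v) = k *: (0, u) + (0, v) :> R * V.
    by apply: injective_projections; rewrite /= ?scaler0 ?addr0.
  by rewrite linearP /= /GRing.scale /=; field.
pose BL : {linear V -> R} := HB.pack B (GRing.isLinear.Build _ _ _ _ B linB).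
have cB : continuous BL.
  move=> v.
  apply: (@continuousM _ _ (fun v => - 'd H p (0, v)) (cst a^-1)); last first.
    exact: cst_continuous.
  apply: (@continuousN _ _ _ (fun v => 'd H p (0, v))).
  apply: (@continuous_comp _ _ _ (fun v : V => ((0 : R), v)) ('d H p)) => //.
  by apply: differentiable_continuous; exact: differentiable_pair.
have [M M0 BM] : exists2 M, 0 < M & forall v, `|BL v| <= M * `|v|.
  have /linear_bounded_continuous/linear_boundedP := cB.
  (* The bound holds for every constant above some [M] of unknown sign; [Num.max M 0 + 1] is such a
     constant and is positive. *)
  move=> [M [_ bd]]; exists (Num.max M 0 + 1).
    by rewrite ltr_wpDl// le_max lexx orbT.
  by move=> v; apply: bd; rewrite ltr_pwDr// le_max lexx.
have {}a0 : 0 < `|a| by rewrite normr_gt0.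
suff [? dE] : differentiable f x /\ 'd f x = BL :> (V -> R).
  by split=> // v; rewrite dE.
apply: small_increment_differentiable => // e e0.
(* With [D = f (h + x) - f x], differentiability of [H] bounds [D - B h] by a
   small multiple of [|D| + |h|]; absorbing [|D|] gives [|D| <= (2 M + 1) |h|]. *)
pose n := Num.min (e / (2 * M + 2)) (1 / 2).
have n0 : 0 < n.
  by rewrite lt_min !divr_gt0// addr_gt0// mulr_gt0.
have na0 : 0 < n * `|a| by rewrite mulr_gt0.
have cpair : (f (h + x) - f x, h) @[h --> (0 : V)] --> ((0 : R), (0 : V)).
  apply: cvg_to_pair; last exact: cvg_id.
  have cfs : f (h + x) @[h --> (0 : V)] --> f x.
    have cs : h + x @[h --> (0 : V)] --> x.
      rewrite -[X in _ --> X]add0r; apply: cvgD; [exact: cvg_id|exact: cvg_cst].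
    exact: cvg_comp cs cf.
  by rewrite -[X in _ --> X](subrr (f x)); apply: cvgB => //; exact: cvg_cst.
have near0 : \forall h \near (0 : V), H (f (h + x), h + x) = 0.
  have cs : h + x @[h --> (0 : V)] --> x.
    rewrite -[X in _ --> X]add0r; apply: cvgD; [exact: cvg_id|exact: cvg_cst].
  exact: cs _ H0.
have smallH := cpair _ (differentiable_small_increment dH na0).
near=> h.
have Hh : H (f (h + x), h + x) = 0 by near: h.
have Hs : `|H ((f (h + x) - f x, h) + p) - H p - 'd H p (f (h + x) - f x, h)|
    <= n * `|a| * `|(f (h + x) - f x, h)|.
  by near: h; exact: smallH.
have Hx : H (f x, x) = 0 := nbhs_singleton H0.
set D := f (h + x) - f x.
(* The tolerance for [H] is [n] times the norm of [a], so that the factor [a] in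
   [D * a + 'd H p (0, h) = (D - B h) * a] cancels. *)
have key : `|D - B h| * `|a| <= n * `|a| * (`|D| + `|h|).
  move: Hs; rewrite -/D.
  have -> : (D, h) + p = (f (h + x), h + x).
    by apply: injective_projections; rewrite //= subrK.
  rewrite Hh Hx subr0 sub0r normrN dHE.
  have -> : D * a + 'd H p (0, h) = (D - B h) * a.
    by rewrite /B; field; rewrite -normr_gt0.
  rewrite normrM => /le_trans; apply; apply: ler_wpM2l; first exact: ltW.
  by rewrite prod_normE /= ge_max lerDl lerDr !normr_ge0.
have {}key : `|D - B h| <= n * (`|D| + `|h|).
  by rewrite -(ler_pM2r a0) mulrAC.
have n12 : n <= 1 / 2 by rewrite ge_min lexx orbT.
have ne : n * (2 * M + 2) <= e.
  by rewrite -ler_pdivlMr ?ge_min ?lexx// addr_gt0// mulr_gt0.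
have h0 := normr_ge0 h; have D0 := normr_ge0 D.
have DB : `|D| <= `|D - B h| + M * `|h|.
  rewrite -{1}(subrK (B h) D); apply: (le_trans (ler_normD _ _)).
  by rewrite lerD2l; exact: BM.
(* Since [n <= 1 / 2], half of the norm of [D] is absorbed on the left. The norms of [D] and [h]
   then add up to at most [2 * M + 2] times that of [h], whence the denominator in [n]. *)
have DM : `|D| <= (2 * M + 1) * `|h|.
  have : n * (`|D| + `|h|) <= 1 / 2 * (`|D| + `|h|).
    by apply: ler_wpM2r => //; exact: addr_ge0.
  lra.
apply: (le_trans key).
have : n * (`|D| + `|h|) <= n * ((2 * M + 2) * `|h|).
  by apply: ler_wpM2l; [exact: ltW|lra].
move=> /le_trans; apply; rewrite mulrA; exact: ler_wpM2r.
Unshelve. all: by end_near. Qed.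

End implicit_function.

(** Near the base point the partial derivative in [y] is positive, so each [H (., x)] is strictly
    increasing and changes sign between [y0 - r] and [y0 + r]. The root is continuous because sign
    changes trap it, and then C1 by [implicit_diff]. *)
Lemma scalar_implicit_function (R : realType) (V : normedModType R)
    (H : R * V -> R) (W : set (R * V)) (y0 : R) (x0 : V) :
  nbhs (y0, x0) W -> (forall p, W p -> C1_at H p) ->
  H (y0, x0) = 0 -> 0 < 'd H (y0, x0) (1, 0) ->
  exists (r d : R) (f : V -> R), [/\ 0 < r /\ 0 < d,
    (forall x, ball x0 d x ->
       [/\ `|f x - y0| < r, H (f x, x) = 0 & W (f x, x)]),
    (forall x y, ball x0 d x -> `|y - y0| <= r -> H (y, x) = 0 -> y = f x) &
    (forall x, ball x0 d x -> C1_at f x)].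
Proof.
move=> nW C1H Hp0 dHp0; have Wp0 := nbhs_singleton nW.
have cdH p v : W p -> {for p, continuous (fun q => 'd H q v)}.
  by move=> /C1H[].
have [e e0 eW] : exists2 e, 0 < e &
    forall y x, ball y0 e y -> ball x0 e x ->
      W (y, x) /\ 0 < 'd H (y, x) (1, 0).
  have : \forall p \near (y0, x0), W p /\ 0 < 'd H p (1, 0).
    near=> p; split; near: p; first exact: nW.
    exact: (cdH (y0, x0) (1, 0) Wp0 _ (lt_nbhsr dHp0)).
  move=> /nbhs_ballP[e /= e0 eW]; exists e; first exact: e0.
  move=> y x ye xe.
  exact: (eW (y, x)).
(* Halving [e] puts the closed interval of radius [r] inside the open ball where the partial
   derivative is positive. *)
pose r := e / 2.
have r0 : 0 < r by rewrite divr_gt0.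
have re : r < e by rewrite /r; lra.
have inball y : `|y - y0| <= r -> ball y0 e y.
  by move=> yr; rewrite -ball_normE /= distrC; exact: le_lt_trans re.
have C1Hyx y x : `|y - y0| <= r -> ball x0 e x -> C1_at H (y, x).
  by move=> yr xe; apply: C1H; case: (eW y x) => //; exact: inball.
have dH1 y x : `|y - y0| <= r -> ball x0 e x ->
    is_derive y (1 : R) (fun t => H (t, x)) ('d H (y, x) (1, 0)).
  move=> yr xe; apply: is_derive_partial1; apply: C1_at_differentiable.
  exact: C1Hyx.
have cH1 y x : `|y - y0| <= r -> ball x0 e x ->
    {for y, continuous (fun t => H (t, x))}.
  move=> yr xe; apply: differentiable_continuous; apply/derivable1_diffP.
  by have [] := dH1 y x yr xe.
have inr y : (y0 - r <= y <= y0 + r) = (`|y - y0| <= r) by rewrite ler_distl.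
have mono x y1 y2 : ball x0 e x -> `|y1 - y0| <= r -> `|y2 - y0| <= r ->
    y1 < y2 -> H (y1, x) < H (y2, x).
  move=> xe y1r y2r y12.
  have itv y : y1 <= y <= y2 -> `|y - y0| <= r.
    move: y1r y2r; rewrite -!inr; lra.
  have [c c12 E] : exists2 c, c \in `]y1, y2[ &
      H (y2, x) - H (y1, x) = 'd H (c, x) (1, 0) * (y2 - y1).
    apply: (@MVT _ (fun t => H (t, x)) (fun t => 'd H (t, x) (1, 0))) => //.
      move=> y; rewrite in_itv /= => /andP[? ?]; apply: dH1 => //.
      by apply: itv; rewrite !ltW.
    apply: continuous_in_subspaceT => y; rewrite inE /= in_itv /= => yy.
    by apply: cH1 => //; exact: itv.
  rewrite -subr_gt0 E; apply: mulr_gt0; last by rewrite subr_gt0.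
  move: c12; rewrite in_itv /= => /andP[? ?].
  case: (eW c x) => //; apply: inball; apply: itv; by rewrite !ltW.
have y0r : `|y0 - y0| <= r by rewrite subrr normr0 ltW.
have loR : `|(y0 - r) - y0| <= r by rewrite addrAC subrr add0r normrN ger0_norm// ltW.
have hiR : `|(y0 + r) - y0| <= r by rewrite addrAC subrr add0r ger0_norm// ltW.
have x0e : ball x0 e x0 by exact: ballxx.
have cH2 y x : `|y - y0| <= r -> ball x0 e x ->
    {for x, continuous (fun t => H (y, t))}.
  move=> yr xe; apply: (@continuous_comp _ _ _ (fun t => (y, t)) H).
    by apply: cvg_to_pair; [exact: cvg_cst|exact: cvg_id].
  exact/C1_at_continuous/C1Hyx.
have [d [d0 de dH]] : exists d, [/\ 0 < d, d <= e &
    forall x, ball x0 d x -> H (y0 - r, x) < 0 < H (y0 + r, x)].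
  have lo0 : H (y0 - r, x0) < 0.
    by rewrite -Hp0; apply: mono => //; rewrite ltrBlDr ltrDl.
  have hi0 : 0 < H (y0 + r, x0).
    by rewrite -Hp0; apply: mono => //; rewrite ltrDl.
  have : \forall x \near x0, H (y0 - r, x) < 0 < H (y0 + r, x).
    near=> x; apply/andP; split; near: x.
      exact: (cH2 (y0 - r) x0 loR x0e _ (lt_nbhsl lo0)).
    exact: (cH2 (y0 + r) x0 hiR x0e _ (lt_nbhsr hi0)).
  move=> /nbhs_ballP[d /= d0 dP]; exists (Num.min d e); split.
  - by rewrite lt_min d0.
  - by rewrite ge_min lexx orbT.
  - move=> x xd; apply: dP; apply: le_ball xd; by rewrite ge_min lexx.
have dball x : ball x0 d x -> ball x0 e x by exact: le_ball.
(* The ball condition sits under the existential so that [choice] yields a total function; its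
   values outside the ball are arbitrary. *)
have sol x : exists y, ball x0 d x -> `|y - y0| < r /\ H (y, x) = 0.
  have [xd|] := pselect (ball x0 d x); last by exists 0.
  have xe := dball x xd; have /andP[lo hi] := dH x xd.
  have [y] : exists2 y, y \in `[y0 - r, y0 + r] & H (y, x) = 0.
    apply: (@IVT _ (fun t => H (t, x))); first lra.
      apply: continuous_in_subspaceT => y; rewrite inE /= in_itv /= inr => yr.
      exact: cH1.
    by rewrite ge_min le_max (ltW lo) (ltW hi) orbT.
  rewrite in_itv /= => /andP[y1 y2] Hy; exists y => _; split => //.
  (* The endpoints are excluded because [H] is nonzero there, which makes the bound by [r]
     strict. *)
  rewrite ltr_distl !lt_neqAle y1 y2 !andbT; apply/andP; split; apply/eqP => E.
    by move: lo; rewrite E Hy ltxx.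
  by move: hi; rewrite -E Hy ltxx.
have [f fP] := choice sol.
have uniq x y : ball x0 d x -> `|y - y0| <= r -> H (y, x) = 0 -> y = f x.
  move=> xd yr Hy; have [fr Hf] := fP x xd; have xe := dball x xd.
  have {}fr := ltW fr.
  have [lt|lt|//] := ltgtP y (f x).
    by have := mono _ _ _ xe yr fr lt; rewrite Hy Hf ltxx.
  by have := mono _ _ _ xe fr yr lt; rewrite Hy Hf ltxx.
have Wf x : ball x0 d x -> W (f x, x).
  move=> xd; have [fr _] := fP x xd.
  by case: (eW (f x) x) => //; [apply/inball/ltW|exact: dball].
have dHf x : ball x0 d x -> 'd H (f x, x) (1, 0) != 0.
  move=> xd; have [fr _] := fP x xd; apply: lt0r_neq0.
  by case: (eW (f x) x) => //; [apply/inball/ltW|exact: dball].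
have nbd x : ball x0 d x -> \forall x' \near x, ball x0 d x'.
  move=> xd; apply: open_nbhs_nbhs; split => //; exact: ball_open.
have cf x : ball x0 d x -> {for x, continuous f}.
  move=> xd; have [fr Hf] := fP x xd; have xe := dball x xd.
  apply/cvgrPdist_lt => eps eps0 /=.
  have := fr; rewrite ltr_distl => /andP[lof hif].
  (* [a] and [b] bracket [f x] within [eps / 2], clipped to the interval where [mono] applies. The
     signs of [H (a, .)] and [H (b, .)] persist near [x] and trap [f x']. *)
  pose a := Num.max (f x - eps / 2) (y0 - r).
  pose b := Num.min (f x + eps / 2) (y0 + r).
  have af : a < f x by rewrite gt_max lof; lra.
  have fb : f x < b by rewrite lt_min hif; lra.
  have ar : `|a - y0| <= r.
    by rewrite -inr le_max lexx orbT /= ltW// (lt_trans af).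
  have br : `|b - y0| <= r.
    by rewrite -inr ge_min lexx orbT andbT ltW// (lt_trans _ fb).
  have Ha : H (a, x) < 0 by rewrite -Hf; apply: mono => //; exact: ltW.
  have Hb : 0 < H (b, x) by rewrite -Hf; apply: mono => //; exact: ltW.
  near=> x'.
  have xd' : ball x0 d x' by near: x'; exact: nbd.
  have xe' := dball _ xd'; have [fr' Hf'] := fP x' xd'.
  have Ha' : H (a, x') < 0.
    by near: x'; exact: (cH2 a x ar xe _ (lt_nbhsl Ha)).
  have Hb' : 0 < H (b, x').
    by near: x'; exact: (cH2 b x br xe _ (lt_nbhsr Hb)).
  have af' : a < f x'.
    rewrite ltNge; apply/negP; rewrite le_eqVlt => /orP[/eqP E|lt].
      by move: Ha'; rewrite -E Hf' ltxx.
    by have := mono _ _ _ xe' (ltW fr') ar lt; rewrite Hf' ltNge ltW.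
  have fb' : f x' < b.
    rewrite ltNge; apply/negP; rewrite le_eqVlt => /orP[/eqP E|lt].
      by move: Hb'; rewrite E Hf' ltxx.
    by have := mono _ _ _ xe' br (ltW fr') lt; rewrite Hf' ltNge ltW.
  move: af' fb'; rewrite gt_max lt_min => /andP[? _] /andP[? _].
  rewrite ltr_distl; lra.
exists r, d, f; split => //.
  by move=> x xd; have [] := fP x xd; split => //; exact: Wf.
have C1f x : ball x0 d x -> differentiable f x /\
    forall v, 'd f x v = - 'd H (f x, x) (0, v) / 'd H (f x, x) (1, 0).
  move=> xd; apply: implicit_diff; first exact: cf.
  - exact/C1_at_differentiable/C1H/Wf.
  - exact: dHf.
  - near=> x'; have : ball x0 d x' by near: x'; exact: nbd.
    by case/fP.
move=> x xd; split.
  near=> x'; have : ball x0 d x' by near: x'; exact: nbd.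
  by case/C1f.
(* The formula for ['d f] holds on a whole neighbourhood, so its continuity follows from that of
   ['d H] along the graph [t |-> (f t, t)]. *)
move=> v; apply: (@near_continuous_for _ _ _
    (fun x => - 'd H (f x, x) (0, v) / 'd H (f x, x) (1, 0))).
  near=> x'; have : ball x0 d x' by near: x'; exact: nbd.
  by case/C1f.
have cpartial w : {for x, continuous (fun x => 'd H (f x, x) w)}.
  apply: (@continuous_comp _ _ _ (fun t => (f t, t)) (fun q => 'd H q w)).
    by apply: cvg_to_pair; [exact: cf|exact: cvg_id].
  exact/cdH/Wf.
apply: continuousM; first exact/continuousN/cpartial.
by apply: continuousV; [exact: dHf|exact: cpartial].
Unshelve. all: by end_near. Qed.

(** * Existence of a power flow solution in a box *)

(* The load voltage is eliminated through the larger root of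
   [v ^ 2 - S v - k gQ = 0] with [S = sqrt (1 - psi ^ 2) - rt psi], which is
   nonincreasing in [psi]; the intermediate value theorem then gives [psi]. *)
Lemma power_flow_exists (R : realType) (k ro rt gP gQ psiE vE : R) :
  0 < k -> 0 <= ro -> 0 <= rt -> gP <= 0 -> gQ <= 0 -> k * gP + rt <= 0 ->
  psiE < 1 -> 0 < vE <= 1 -> 0 <= vE ^+ 2 + k * gQ ->
  psiE = - k * gP / vE + ro * (2 - vE) + rt ->
  vE = k * gQ / vE - rt * psiE + Num.sqrt (1 - psiE ^+ 2) ->
  exists psi x : R, [/\ 0 <= psi <= psiE, vE - 1 <= x <= 0,
    psi = - k * gP / (x + 1) + ro * (x + 1) - rt * Num.sqrt (1 - psi ^+ 2) &
    x = k * gQ / (x + 1) - rt * psi + Num.sqrt (1 - psi ^+ 2) - 1].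
Proof.
move=> k0 ro0 rt0 gP0 gQ0 kgPrt psiE1 /andP[vE0 vE1] vEQ eqnP eqnQ.
have kgP : 0 <= - k * gP by rewrite mulNr oppr_ge0 mulr_ge0_le0 ?(ltW k0).
have kgQ : k * gQ <= 0 by rewrite mulr_ge0_le0 ?(ltW k0).
have psiE0 : 0 <= psiE.
  rewrite eqnP addr_ge0// addr_ge0//; first by rewrite divr_ge0// ltW.
  by apply: mulr_ge0 => //; lra.
pose S psi : R := Num.sqrt (1 - psi ^+ 2) - rt * psi.
pose v psi : R := (S psi + Num.sqrt (S psi ^+ 2 + 4 * (k * gQ))) / 2.
(* The reactive equation at [psiE] makes the discriminant a perfect square; as [vE ^+ 2 + k * gQ] is
   nonnegative, the larger root at [psiE] is [vE] itself. *)
have SE : S psiE = vE - k * gQ / vE.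
  by rewrite /S; lra.
have kgQv : k * gQ / vE <= 0 by rewrite mulr_le0_ge0// invr_ge0 ltW.
have SE0 : 0 < S psiE by rewrite SE; lra.
have vSE : 0 <= vE + k * gQ / vE.
  have -> : vE + k * gQ / vE = (vE ^+ 2 + k * gQ) / vE.
    by field; rewrite gt_eqF.
  by rewrite divr_ge0// ltW.
have sqE : S psiE ^+ 2 + 4 * (k * gQ) = (vE + k * gQ / vE) ^+ 2.
  by rewrite SE; field; rewrite gt_eqF.
have vpsiE : v psiE = vE by rewrite /v sqE sqrtr_sqr ger0_norm// SE; lra.
have SS psi : 0 <= psi <= psiE -> S psiE <= S psi.
  move=> /andP[p0 p1]; apply: lerB; last exact: ler_wpM2l.
  by rewrite ler_wsqrtr// lerB// lerXn2r.
have sqS psi : 0 <= psi <= psiE -> 0 <= S psi ^+ 2 + 4 * (k * gQ).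
  move=> pp; have := sqr_ge0 (vE + k * gQ / vE); rewrite -sqE.
  have : S psiE ^+ 2 <= S psi ^+ 2.
    by rewrite lerXn2r ?SS// nnegrE ?ltW// (lt_le_trans SE0)// SS.
  lra.
have vv psi : 0 <= psi <= psiE -> vE <= v psi.
  move=> pp; rewrite -vpsiE /v ler_pM2r ?invr_gt0// lerD ?SS// ler_wsqrtr//.
  by rewrite lerD2r lerXn2r ?SS// nnegrE ?ltW// (lt_le_trans SE0)// SS.
have vquad psi : 0 <= psi <= psiE -> v psi = k * gQ / v psi + S psi.
  move=> pp; have v0 : 0 < v psi := lt_le_trans vE0 (vv _ pp).
  have sq := sqr_sqrtr (sqS _ pp).
  suff E : v psi ^+ 2 = k * gQ + S psi * v psi.
    apply: (mulIf (lt0r_neq0 v0)); rewrite -expr2 E.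
    by field; rewrite gt_eqF.
  rewrite /v; move: sq; set z := Num.sqrt _ => sq.
  have -> : ((S psi + z) / 2) ^+ 2 = (S psi ^+ 2 + 2 * S psi * z + z ^+ 2) / 4.
    by field.
  by rewrite sq; field.
(* By the quadratic, [v psi] is at most [S psi], hence at most [1]. *)
have v1 psi : 0 <= psi <= psiE -> v psi <= 1.
  move=> pp; have v0 : 0 < v psi := lt_le_trans vE0 (vv _ pp).
  rewrite vquad//; have /andP[p0 p1] := pp.
  have : k * gQ / v psi <= 0 by rewrite mulr_le0_ge0// invr_ge0 ltW.
  have : Num.sqrt (1 - psi ^+ 2) <= 1.
    by rewrite -[leRHS]sqrtr1 ler_wsqrtr// lerBlDr lerDl sqr_ge0.
  have : 0 <= rt * psi by rewrite mulr_ge0.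
  rewrite /S; lra.
(* [L] is the defect of the active power equation once [v] solves the reactive one. *)
pose L psi : R :=
  psi - (- k * gP / v psi + ro * v psi - rt * Num.sqrt (1 - psi ^+ 2)).
have cs1 : continuous (fun psi : R => Num.sqrt (1 - psi ^+ 2)).
  move=> psi.
  apply: (@continuous_comp _ _ _ (fun psi : R => 1 - psi ^+ 2) (@Num.sqrt R)).
    apply: continuousB; [exact: cst_continuous|exact: exprn_continuous].
  exact: sqrt_continuous.
have cS : continuous S.
  move=> psi; apply: (@continuousB _ _ _ (fun psi : R => Num.sqrt (1 - psi ^+ 2))
    (fun psi => rt * psi)); first exact: cs1.
  by apply: continuousM; [exact: cst_continuous|exact: cvg_id].
have cv : continuous v.
  move=> psi; apply: (@continuousM _ _
    (fun psi => S psi + Num.sqrt (S psi ^+ 2 + 4 * (k * gQ))) (cst 2^-1));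
    last exact: cst_continuous.
  apply: continuousD; first exact: cS.
  apply: (@continuous_comp _ _ _ (fun psi : R => S psi ^+ 2 + 4 * (k * gQ))
    (@Num.sqrt R)); last exact: sqrt_continuous.
  apply: continuousD; last exact: cst_continuous.
  apply: (@continuous_comp _ _ _ S (fun t => t ^+ 2)); first exact: cS.
  exact: exprn_continuous.
have [psi] : exists2 psi, psi \in `[0, psiE] & L psi = 0.
  apply: IVT => //.
    apply: continuous_in_subspaceT => psi; rewrite inE /= in_itv /= => pp.
    apply: (@continuousB _ _ _ id (fun psi => - k * gP / v psi + ro * v psi -
      rt * Num.sqrt (1 - psi ^+ 2))); first exact: cvg_id.
    apply: continuousB; last first.
      by apply: continuousM; [exact: cst_continuous|exact: cs1].
    apply: continuousD; last first.
      by apply: continuousM; [exact: cst_continuous|exact: cv].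
    apply: continuousM; first exact: cst_continuous.
    apply: continuousV; last exact: cv.
    by rewrite gt_eqF// (lt_le_trans vE0)// vv.
  have p00 : 0 <= (0 : R) <= psiE by rewrite lexx.
  have pEE : 0 <= psiE <= psiE by rewrite lexx andbT.
  rewrite ge_min le_max; apply/andP; split; apply/orP; [left|right].
    (* At [psi = 0] the square root is [1], and [v 0 <= 1] gives [- k * gP / v 0 >= - k * gP >= rt],
       so [L 0 <= 0]. *)
    rewrite /L expr0n subr0 sqrtr1 mulr1 sub0r oppr_le0.
    have v0 : 0 < v 0 := lt_le_trans vE0 (vv _ p00).
    have : - k * gP <= - k * gP / v 0.
      by rewrite ler_peMr// invf_ge1// v1.
    have : 0 <= ro * v 0 by rewrite mulr_ge0// ltW.
    lra.
  (* The bounding equation carries [2 - vE >= vE] in place of [vE], and [+ rt] in place of [- rt]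
     times the square root, so [L psiE >= 0]. *)
  rewrite /L vpsiE {1}eqnP.
  have : 0 <= rt * Num.sqrt (1 - psiE ^+ 2) by rewrite mulr_ge0// sqrtr_ge0.
  have : ro * vE <= ro * (2 - vE) by apply: ler_wpM2l => //; lra.
  lra.
rewrite in_itv /= => pp Lpsi; exists psi, (v psi - 1); rewrite subrK; split => //.
- by rewrite lerB ?vv//= subr_le0 v1.
- by apply/eqP; rewrite -subr_eq0 -/(L psi) Lpsi.
- by rewrite {1}vquad// /S; lra.
Qed.

(** * The operating point at zero perturbation *)

Section base_point.
Context {R : realType} (gP gQ : R).
Hypotheses (margin : 0 < 4 * gP ^+ 2 - 4 * gQ < 1) (gQ0 : gQ <= 0) (gP0 : gP < 0).
Let v : R := 1 - k2_minus gP gQ.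

(** [w = v ^+ 2] is a root of [w ^+ 2 - (1 + 2 * gQ) * w + gP ^+ 2 + gQ ^+ 2], an equation rewritten
    here as [(w - gQ) ^+ 2 = w - gP ^+ 2]; lying above the midpoint [1 / 2 + gQ] singles out the
    larger root. *)
Lemma base_voltage :
  [/\ 0 < v < 1, 1 / 2 + gQ < v ^+ 2 & (v ^+ 2 - gQ) ^+ 2 = v ^+ 2 - gP ^+ 2].
Proof.
have gQle := gQ0; have /andP[m0 m1] := margin; have gP2 : 0 < gP ^+ 2 by rewrite exprn_even_gt0//= lt_eqF.
have disc : 0 < 1 / 4 + gQ - gP ^+ 2 by lra.
pose s : R := Num.sqrt (1 / 4 + gQ - gP ^+ 2).
have s0 : 0 < s by rewrite sqrtr_gt0.
have s2 : s ^+ 2 = 1 / 4 + gQ - gP ^+ 2 by rewrite sqr_sqrtr// ltW.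
have s12 : s < 1 / 2.
  by rewrite -(@ltr_pXn2r _ 2) ?nnegrE ?ltW// s2; lra.
have w0 : 0 < 1 / 2 + gQ + s by lra.
have vE : v = Num.sqrt (1 / 2 + gQ + s) by rewrite /v /k2_minus opprB addrC subrK.
have v2 : v ^+ 2 = 1 / 2 + gQ + s by rewrite vE sqr_sqrtr// ltW.
have v0 : 0 < v by rewrite vE sqrtr_gt0.
split; [|lra|].
- by rewrite v0 -(@ltr_pXn2r _ 2) ?nnegrE ?ltW// v2 expr1n /=; lra.
- rewrite v2; have -> : (1 / 2 + gQ + s - gQ) ^+ 2 = 1 / 4 + s + s ^+ 2 by field.
  by rewrite s2; lra.
Qed.

Let v_gt0 : 0 < v. Proof. by have [/andP[]] := base_voltage. Qed.

(** The cosine of the branch angle whose sine is [k1 = - gP / v]; the quadratic turns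
    [v ^+ 2 - gP ^+ 2] into a perfect square. *)
Lemma base_sine_sqrt : Num.sqrt (1 - (gP / v) ^+ 2) = (v ^+ 2 - gQ) / v.
Proof.
have gQle := gQ0; have [_ h1 h2] := base_voltage; have v0 := v_gt0.
have -> : 1 - (gP / v) ^+ 2 = ((v ^+ 2 - gQ) / v) ^+ 2.
  by rewrite !expr_div_n h2; field; rewrite gt_eqF.
by rewrite sqrtr_sqr ger0_norm// divr_ge0 ?ltW//; have := sqr_ge0 v; lra.
Qed.

(** With [w = v ^+ 2] the quadratic gives [gP ^+ 2 + gQ ^+ 2 = 2 * w * (1 / 2 + gQ) - w ^+ 2], and
    [1 / 2 + gQ < w]. *)
Lemma base_norm_lt : gP ^+ 2 + gQ ^+ 2 < (v ^+ 2) ^+ 2.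
Proof.
have gQle := gQ0; have [_ h1 h2] := base_voltage; have v0 := v_gt0.
have v2 : 0 < v ^+ 2 by rewrite exprn_gt0.
have : v ^+ 2 * (1 / 2 + gQ) < v ^+ 2 * v ^+ 2 by rewrite ltr_pM2l.
move: h2; set w : R := v ^+ 2; rewrite !expr2; lra.
Qed.

(** Makes [v] the larger root when the load voltage is eliminated; being strict, it survives small
    perturbations. *)
Lemma base_voltage_gt : 0 < v ^+ 2 + gQ.
Proof.
have gQle := gQ0; have v2 : 0 < v ^+ 2 by rewrite exprn_gt0// v_gt0.
have := base_norm_lt; have := sqr_ge0 gP => ? ?.
suff : - gQ < v ^+ 2 by lra.
have : (- gQ) ^+ 2 < (v ^+ 2) ^+ 2 by rewrite sqrrN; lra.
by rewrite ltr_pXn2r// nnegrE ?oppr_ge0// ltW.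
Qed.

(** The function is [reduced_E2] at zero perturbation, where the branch sine is [gP / (v - y)] up to
    sign. *)
Lemma base_is_derive :
  exists2 c : R, 0 < c & is_derive (0 : R) (1 : R) (fun y : R =>
    y - (- gQ / (v - y) + v - Num.sqrt (1 - (gP / (v - y)) ^+ 2))) c.
Proof.
have gQle := gQ0; have v0 := v_gt0; have vn0 : v != 0 by rewrite gt_eqF.
have v2 : 0 < v ^+ 2 by rewrite exprn_gt0.
have vQ : 0 < v ^+ 2 - gQ by lra.
have u0 : (v - 0)^-1 = v^-1 by rewrite subr0.
have du : is_derive (0 : R) (1 : R) (fun y : R => (v - y)^-1) (v ^- 2).
  have dv : is_derive (0 : R) (1 : R) (fun y : R => v - y) (-1).
    by rewrite -[X in is_derive _ _ _ X]add0r; exact: is_deriveB.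
  have vy0 : v - 0 != 0 by rewrite subr0.
  have := @is_deriveV R (fun y : R => v - y) 0 (-1) 1 vy0 dv.
  rewrite subr0 => dV; apply: (@is_derive_eq _ _ _ _ _ _ _ _ dV).
  by rewrite /GRing.scale /= mulrN1 opprK.
have drad : is_derive (0 : R) (1 : R) (fun y : R => 1 - (gP / (v - y)) ^+ 2)
    (- (2 * gP ^+ 2 / v ^+ 3)).
  apply: is_derive_eq.
  by rewrite /GRing.scale /= u0; field.
have rad0 : 0 < 1 - (gP / (v - 0)) ^+ 2.
  by rewrite subr0 -sqrtr_gt0 base_sine_sqrt divr_gt0.
have dsq := is_derive1_sqrt rad0.
have dsqrt : is_derive (0 : R) (1 : R)
    (fun y : R => Num.sqrt (1 - (gP / (v - y)) ^+ 2)) _ :=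
  @is_derive1_comp R (@Num.sqrt R) (fun y : R => 1 - (gP / (v - y)) ^+ 2)
    0 _ _ dsq drad.
(* The summands come from [y], the reactive term and the square root, the last one evaluated through
   [base_sine_sqrt]. *)
exists (1 + gQ / v ^+ 2 - gP ^+ 2 / (v ^+ 2 * (v ^+ 2 - gQ))).
  have -> : 1 + gQ / v ^+ 2 - gP ^+ 2 / (v ^+ 2 * (v ^+ 2 - gQ)) =
      ((v ^+ 2) ^+ 2 - (gP ^+ 2 + gQ ^+ 2)) / (v ^+ 2 * (v ^+ 2 - gQ)).
    by field; rewrite vn0 gt_eqF.
  by rewrite divr_gt0 ?mulr_gt0// subr_gt0 base_norm_lt.
apply: is_derive_eq.
rewrite subr0 base_sine_sqrt /GRing.scale /=; field.
by rewrite vn0 gt_eqF.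
Qed.

End base_point.

(** * From scalar coordinates to row vectors *)

Lemma continuous_mx (R : realType) (T : topologicalType) (m n : nat)
    (A : T -> 'M[R]_(m, n)) (x : T) :
  (forall i j, {for x, continuous (fun t => A t i j)}) ->
  {for x, continuous A}.
Proof.
move=> cA; apply/cvgrPdist_le => e e0; near=> t.
rewrite /Num.Def.normr/= mx_normrE (bigmax_le _ (ltW e0))//= => i _.
rewrite !mxE/=; move: i; near: t; apply: filter_forall => /= i.
by have /cvgrPdist_le := cA i.1 i.2; apply.
Unshelve. all: by end_near. Qed.

(** Entry [(i, j)] of the Jacobian is the differential of coordinate [j] in the [i]-th basis
    direction, which is why the directional continuity in [C1_at] is enough. *)
Lemma C1_on_coord (R : realType) (n m : nat) (U : set 'rV[R]_n.+1)
    (f : 'rV[R]_n.+1 -> 'rV[R]_m.+1) :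
  (forall x, U x -> forall j, C1_at (fun q => f q 0 j) x) -> C1_on U f.
Proof.
move=> C1f x Ux.
have fE : f = \sum_j (fun q => f q 0 j *: delta_mx 0 j).
  by apply/funext => q; rewrite fct_sumE -row_sum_delta.
have df : \forall q \near x, differentiable f q.
  near=> q.
  have dq : forall j, differentiable (fun q => f q 0 j) q.
    by near: q; apply: filter_forall => j; case: (C1f x Ux j).
  rewrite fE; apply: differentiable_sum => j.
  by apply: differentiableZl; exact: dq.
split; first exact: (nbhs_singleton df).
apply: continuous_mx => i j.
have [_ /(_ (delta_mx 0 i))] := C1f x Ux j.
apply: near_continuous_for; apply: filterS df => q dq.
rewrite /jacobian mxE.
pose c (M : 'rV[R]_m.+1) : R := M 0 j.
have linc : linear c by move=> k u v; rewrite /c !mxE.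
pose cL : {linear 'rV[R]_m.+1 -> R} :=
  HB.pack c (GRing.isLinear.Build _ _ _ _ c linc).
have cc : continuous cL by exact: coord_continuous.
have dc : 'd c (f q) = c :> ('rV[R]_m.+1 -> R) := @diff_lin _ _ _ cL (f q) cc.
have dcf := differentiable_coord (f q) 0 j.
have -> : 'd (fun q => f q 0 j) q = c \o 'd f q :> (_ -> R).
  by rewrite -{1}dc; exact: (@diff_comp _ _ _ _ f c).
by [].
Unshelve. all: by end_near. Qed.

(** * Smooth dependence of the branch constants on the perturbation *)

Section branch_C1.
Context {R : realType} {V : normedModType R} (b gP gQ : R).
Variables (M : V -> 'rV[R]_4) (p : V).
Hypothesis C1M : forall i, C1_at (fun q => M q 0 i) p.

(** Positivity, rather than mere nonvanishing, of the denominators: with [0 < b] it also makes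
    [k_pert] positive. *)
Definition regular_branch (mu : 'rV[R]_4) : Prop :=
  [/\ 0 < pert_tbar mu + 1,
      0 < b * cos (pert_theta mu) + pert_g mu * sin (pert_theta mu) &
      0 < b_hat b mu].

Hypothesis regM : regular_branch (M p).

Lemma C1_b_hat : C1_at (fun q => b_hat b (M q)) p.
Proof.
apply: C1_at_add; first exact: C1_at_cst.
by apply/C1_at_opp/C1_at_mul; [exact: C1M|exact: C1_at_cst].
Qed.

Lemma C1_tap : C1_at (fun q => (pert_tbar (M q) + 1)^-1) p.
Proof.
have [t0 _ _] := regM; apply: C1_at_inv; first by rewrite gt_eqF.
by apply: C1_at_add; [exact: C1M|exact: C1_at_cst].
Qed.

Lemma b_tilde_gt0 mu : regular_branch mu -> 0 < b_tilde b mu.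
Proof. by move=> [? ? _]; rewrite divr_gt0. Qed.

Lemma C1_g_tilde : C1_at (fun q => g_tilde b (M q)) p.
Proof.
apply: C1_at_mul; last exact: C1_tap.
apply: C1_at_add; first by apply: C1_at_mul; [exact: C1M|exact/C1_at_cos/C1M].
apply/C1_at_opp/C1_at_mul; [exact: C1_at_cst|exact/C1_at_sin/C1M].
Qed.

Lemma C1_b_tilde : C1_at (fun q => b_tilde b (M q)) p.
Proof.
apply: C1_at_mul; last exact: C1_tap.
apply: C1_at_add.
  by apply: C1_at_mul; [exact: C1_at_cst|exact/C1_at_cos/C1M].
by apply: C1_at_mul; [exact: C1M|exact/C1_at_sin/C1M].
Qed.

Lemma C1_k_pert : C1_at (fun q => k_pert b (M q)) p.
Proof.
apply: C1_at_mul; first by apply: C1_at_mul; [exact: C1_at_cst|exact: C1_b_hat].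
apply: C1_at_inv; first by rewrite expf_neq0// gt_eqF// b_tilde_gt0.
by apply: C1_at_mul; exact: C1_b_tilde.
Qed.

Lemma C1_rho : C1_at (fun q => rho b (M q)) p.
Proof.
apply: C1_at_mul; first exact: C1M.
by apply: C1_at_inv; [have [_ _ /lt0r_neq0] := regM|exact: C1_b_hat].
Qed.

Lemma C1_rho_tilde : C1_at (fun q => rho_tilde b (M q)) p.
Proof.
apply: C1_at_mul; first exact: C1_g_tilde.
by apply: C1_at_inv; [rewrite gt_eqF// b_tilde_gt0|exact: C1_b_tilde].
Qed.

Definition eps1_of (y : R) (mu : 'rV[R]_4) : R :=
  - k_pert b mu * gP / (1 - k2_minus gP gQ - y) + gP / (1 - k2_minus gP gQ)
  + rho b mu * (1 + k2_minus gP gQ + y) + rho_tilde b mu.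

(** This is [- E2] with [eps 0 0] eliminated; the sign makes its derivative in [y] positive at the
    origin. *)
Definition reduced_E2 (y : R) (mu : 'rV[R]_4) : R :=
  y - (- k_pert b mu * gQ / (1 - k2_minus gP gQ - y) + (1 - k2_minus gP gQ)
       + rho_tilde b mu * (k1_minus gP gQ + eps1_of y mu)
       - Num.sqrt (1 - (k1_minus gP gQ + eps1_of y mu) ^+ 2)).

Variable Y : V -> R.
Hypotheses (C1Y : C1_at Y p) (Yp : Y p < 1 - k2_minus gP gQ).

Lemma C1_voltage_inv : C1_at (fun q => (1 - k2_minus gP gQ - Y q)^-1) p.
Proof.
apply: C1_at_inv; first by rewrite gt_eqF// subr_gt0.
by apply: C1_at_add; [exact: C1_at_cst|exact: C1_at_opp].
Qed.

(** The inner maps [Y] and [M] serve twice: as the projections of a product, for the scalar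
    equation, and as the scalar root and the identity, for the first coordinate of the solution. *)
Lemma C1_eps1_of : C1_at (fun q => eps1_of (Y q) (M q)) p.
Proof.
apply: C1_at_add; last exact: C1_rho_tilde.
apply: C1_at_add; last first.
  apply: C1_at_mul; first exact: C1_rho.
  by apply: C1_at_add; [exact: C1_at_cst|exact: C1Y].
apply: C1_at_add; last exact: C1_at_cst.
apply: C1_at_mul; last exact: C1_voltage_inv.
by apply: C1_at_mul; [apply: C1_at_opp; exact: C1_k_pert|exact: C1_at_cst].
Qed.

Lemma C1_reduced_E2 :
  -1 - k1_minus gP gQ < eps1_of (Y p) (M p) < 1 - k1_minus gP gQ ->
  C1_at (fun q => reduced_E2 (Y q) (M q)) p.
Proof.
move=> /andP[lo hi].
have C1psi : C1_at (fun q => k1_minus gP gQ + eps1_of (Y q) (M q)) p.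
  by apply: C1_at_add; [exact: C1_at_cst|exact: C1_eps1_of].
apply: C1_at_add; first exact: C1Y.
apply: C1_at_opp; apply: C1_at_add; last first.
  apply/C1_at_opp/C1_at_sqrt.
    (* The radicand is a difference of squares whose two factors are positive by [lo] and [hi]. *)
    rewrite -{1}(expr1n _ 2) subr_sqr mulr_gt0//; lra.
  apply: C1_at_add; first exact: C1_at_cst.
  by apply/C1_at_opp/C1_at_mul; exact: C1psi.
apply: C1_at_add; last by apply: C1_at_mul; [exact: C1_rho_tilde|exact: C1psi].
apply: C1_at_add; last exact: C1_at_cst.
apply: C1_at_mul; last exact: C1_voltage_inv.
by apply: C1_at_mul; [apply: C1_at_opp; exact: C1_k_pert|exact: C1_at_cst].
Qed.

End branch_C1.

Lemma E_eq0P (R : realType) (b gP gQ : R) (eps : 'rV[R]_2) (mu : 'rV[R]_4) :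
  E b gP gQ eps mu = 0 <->
  eps 0 0 = eps1_of b gP gQ (eps 0 1) mu /\
  reduced_E2 b gP gQ (eps 0 1) mu = 0.
Proof.
rewrite /reduced_E2; split=> [/rowP E0|[e0]].
  have := E0 0; have := E0 1; rewrite !mxE /= => E2 E1.
  have e0 : eps 0 0 = eps1_of b gP gQ (eps 0 1) mu.
    by move: E1; rewrite /E1 /eps1_of; lra.
  by split=> //; rewrite -e0; move: E2; rewrite /E2; lra.
rewrite -e0 => e1; apply/rowP => i; rewrite !mxE.
by case: ifP => _; [move: e0; rewrite /E1 /eps1_of; lra|rewrite /E2; lra].
Qed.

(** * The equations at zero perturbation *)

Section unperturbed.
Context {R : realType} (b gP gQ : R).
Hypothesis b0 : 0 < b.

Lemma regular_branch0 : regular_branch b 0.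
Proof.
rewrite /regular_branch /b_hat /pert_tbar /pert_theta /pert_g /pert_bc !mxE.
by rewrite cos0 sin0 mulr0 mul0r add0r addr0 subr0 mulr1.
Qed.

Lemma k_pert0 : k_pert b 0 = 1.
Proof.
rewrite /k_pert /b_hat /b_tilde /pert_tbar /pert_theta /pert_g /pert_bc !mxE.
by rewrite cos0 sin0; field; rewrite gt_eqF.
Qed.

Lemma rho0 : rho b 0 = 0.
Proof. by rewrite /rho /pert_g mxE mul0r. Qed.

Lemma rho_tilde0 : rho_tilde b 0 = 0.
Proof.
rewrite /rho_tilde /g_tilde /pert_theta /pert_g !mxE.
by rewrite sin0 mulr0 mul0r subr0 !mul0r.
Qed.

Lemma eps1_of0 y : eps1_of b gP gQ y 0 =
  - gP / (1 - k2_minus gP gQ - y) + gP / (1 - k2_minus gP gQ).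
Proof. by rewrite /eps1_of k_pert0 rho0 rho_tilde0 mulN1r mul0r !addr0. Qed.

(** The two terms in [gP / (1 - k2_minus gP gQ)] cancel in the sum of [k1_minus gP gQ] and
    [eps1_of], and the remaining sign disappears under the square. *)
Lemma reduced_E20 y : reduced_E2 b gP gQ y 0 =
  y - (- gQ / (1 - k2_minus gP gQ - y) + (1 - k2_minus gP gQ) -
       Num.sqrt (1 - (gP / (1 - k2_minus gP gQ - y)) ^+ 2)).
Proof.
rewrite /reduced_E2 k_pert0 rho_tilde0 eps1_of0 mulN1r mul0r addr0 /k1_minus.
have -> : - gP / (1 - k2_minus gP gQ) + (- gP / (1 - k2_minus gP gQ - y) +
  gP / (1 - k2_minus gP gQ)) = - (gP / (1 - k2_minus gP gQ - y)) by ring.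
by rewrite sqrrN.
Qed.

End unperturbed.

(** * Plane vectors, a segment argument and coordinate maps *)

Definition row2 (R : realType) (a c : R) : 'rV[R]_2 :=
  \row_(j < 2) (if j == 0 then a else c).

Lemma row2_eta (R : realType) (x : 'rV[R]_2) : x = row2 (x 0 0) (x 0 1).
Proof.
apply/rowP => j; rewrite mxE; case: ifPn => [/eqP->//|j0].
by congr (x 0 _); apply/val_inj; case: j j0 => [[|[|]]].
Qed.

Lemma continuous_row2 (R : realType) (T : topologicalType) (a c : T -> R) (x : T) :
  {for x, continuous a} -> {for x, continuous c} ->
  {for x, continuous (fun t => row2 (a t) (c t))}.
Proof.
move=> ca cc; apply: continuous_mx => i j; rewrite (ord1 i).
have [->|j1] := eqVneq j 0.
  by apply: near_continuous_for ca; apply: nearW => q; rewrite mxE eqxx.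
by apply: near_continuous_for cc; apply: nearW => q; rewrite mxE (negbTE j1).
Qed.

(* Intermediate value theorem along the segment from [0] to [mu]. *)
Lemma norm_lt_of_avoids (R : realType) (V : normedModType R) (h : V -> R)
    (r d : R) (mu : V) :
  0 < r -> h 0 = 0 -> ball (0 : V) d mu ->
  (forall x, ball (0 : V) d x -> {for x, continuous h}) ->
  (forall x, ball (0 : V) d x -> `|h x| != r) -> `|h mu| < r.
Proof.
move=> r0 h0 muB ch hr; rewrite ltNge; apply/negP => rh.
have tB (t : R) : 0 <= t <= 1 -> ball (0 : V) d (t *: mu).
  move=> /andP[t0 t1]; move: muB; rewrite -!ball_normE /= !sub0r !normrN normrZ.
  by apply: le_lt_trans; rewrite ger0_norm// ler_piMl.
have [t] : exists2 t, t \in `[0, 1] & `|h (t *: mu)| = r.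
  apply: (@IVT _ (fun t => `|h (t *: mu)|)) => //.
    apply: continuous_in_subspaceT => t; rewrite inE /= in_itv /= => t01.
    apply: (@continuous_comp _ _ _ (fun t : R => h (t *: mu)) (@Num.norm _ R)).
      apply: (@continuous_comp _ _ _ (fun t : R => t *: mu) h).
        by apply: differentiable_continuous; exact: differentiableZl.
      exact/ch/tB.
    exact: norm_continuous.
  by rewrite scale0r h0 normr0 scale1r ge_min le_max ltW//= rh orbT.
by rewrite in_itv /= => t01 /eqP; apply/negP/hr/tB.
Qed.

Section coordinates.
Context {R : realType}.
Implicit Type p : R * 'rV[R]_4.

Lemma C1_snd_coord p i : C1_at (fun q : R * 'rV[R]_4 => q.2 0 i) p.
Proof.
apply: C1_at_linear => [k u w|q]; first by rewrite !mxE.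
apply: (@continuous_comp _ _ _ snd (fun M : 'rV[R]_4 => M 0 i)).
  exact: cvg_snd.
exact: coord_continuous.
Qed.

Lemma C1_fst p : C1_at (fun q : R * 'rV[R]_4 => q.1) p.
Proof. by apply: C1_at_linear => [k u w//|q]; exact: cvg_fst. Qed.

Lemma C1_coord (x : 'rV[R]_4) i : C1_at (fun q : 'rV[R]_4 => q 0 i) x.
Proof.
apply: C1_at_linear => [k u w|]; first by rewrite !mxE.
exact: coord_continuous.
Qed.

End coordinates.

(** * The implicit function of the two-bus system *)

Section two_bus.
Context {R : realType} (b gP gQ : R) (D : set 'rV[R]_2).
Hypotheses (b0 : 0 < b) (margin : 0 < 4 * gP ^+ 2 - 4 * gQ < 1)
  (gQ0 : gQ <= 0) (gP0 : gP < 0).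
Hypotheses (oD : open D) (D0 : D 0) (DE : D `<=` E_domain gP gQ).
Let k1 := k1_minus gP gQ.
Let k2 := k2_minus gP gQ.
Let e1 (p : R * 'rV[R]_4) := eps1_of b gP gQ p.1 p.2.
Let residual (p : R * 'rV[R]_4) := reduced_E2 b gP gQ p.1 p.2.

(* The conditions after the second one are those under which a root of [residual]
   bounds a power flow solution. *)
Definition admissible : set (R * 'rV[R]_4) :=
  [set p | [/\ D (row2 (e1 p) p.1), regular_branch b p.2,
     k_pert b p.2 * gP + rho_tilde b p.2 < 0,
     0 < k2 + p.1 &
     0 < (1 - k2 - p.1) ^+ 2 + k_pert b p.2 * gQ]].

Let k2_bounds : 0 < 1 - k2 < 1.
Proof. by have [] := base_voltage margin gQ0. Qed.

(** Every condition is a strict inequality or membership in the open set [D], imposed on functions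
    continuous at the origin, and it holds there. *)
Lemma nbhs_admissible : nbhs ((0, 0) : R * 'rV[R]_4) admissible.
Proof.
have C1M := @C1_snd_coord R ((0, 0) : R * 'rV[R]_4).
have C1Y := @C1_fst R ((0, 0) : R * 'rV[R]_4).
have reg0 := regular_branch0 b0.
have [v0 v1] := andP k2_bounds.
have C1e1 : C1_at e1 (0, 0) by exact: C1_eps1_of.
have C1k := C1_k_pert C1M reg0.
have C1rt := C1_rho_tilde C1M reg0.
have gtc (g : R * 'rV[R]_4 -> R) : C1_at g (0, 0) -> 0 < g (0, 0) ->
    \forall p \near ((0, 0) : R * 'rV[R]_4), 0 < g p.
  by move=> /C1_at_continuous cg g0; exact: (cg _ (lt_nbhsr g0)).
near=> p; split; near: p.
- have crow : {for (0, 0), continuous (fun p : R * 'rV[R]_4 => row2 (e1 p) p.1)}.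
    exact: (continuous_row2 (C1_at_continuous C1e1) (C1_at_continuous C1Y)).
  apply: crow; apply: open_nbhs_nbhs; split => //=.
  have -> : row2 (e1 (0, 0)) 0 = 0; last by [].
  apply/rowP => j; rewrite !mxE /e1 /= eps1_of0// subr0.
  by case: ifP => // _; ring.
- have [t0 c0 h0] := reg0.
  near=> p; split; near: p.
  + apply: gtc; last exact: t0.
    by apply: C1_at_add; [exact: C1M|exact: C1_at_cst].
  + apply: gtc; last exact: c0.
    apply: C1_at_add; apply: C1_at_mul.
    * exact: C1_at_cst.
    * exact/C1_at_cos/C1M.
    * exact: C1M.
    * exact/C1_at_sin/C1M.
  + by apply: gtc; [exact: C1_b_hat|exact: h0].
- have : \forall p \near ((0, 0) : R * 'rV[R]_4),
      0 < - (k_pert b p.2 * gP + rho_tilde b p.2).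
    apply: gtc; last by rewrite /= k_pert0// rho_tilde0 mul1r addr0 oppr_gt0.
    apply/C1_at_opp/C1_at_add; last exact: C1rt.
    by apply: C1_at_mul; [exact: C1k|exact: C1_at_cst].
  by apply: filterS => p; rewrite oppr_gt0.
- apply: gtc; last by rewrite /= addr0; lra.
  by apply: C1_at_add; [exact: C1_at_cst|exact: C1Y].
- apply: gtc; last first.
    by rewrite /= k_pert0// mul1r subr0; exact: base_voltage_gt.
  apply: C1_at_add; last by apply: C1_at_mul; [exact: C1k|exact: C1_at_cst].
  have C1v : C1_at (fun p : R * 'rV[R]_4 => 1 - k2 - p.1) (0, 0).
    by apply: C1_at_add; [exact: C1_at_cst|exact/C1_at_opp/C1Y].
  exact: C1_at_mul.
Unshelve. all: by end_near. Qed.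

Lemma admissible_domain p : admissible p ->
  -1 - k1 < e1 p < 1 - k1 /\ p.1 < 1 - k2.
Proof. by move=> [/DE]; rewrite /E_domain /= !mxE. Qed.

Lemma C1_residual p : admissible p -> C1_at residual p.
Proof.
move=> Ap; have [dom1 dom2] := admissible_domain Ap.
case: Ap => _ reg _ _ _.
apply: C1_reduced_E2; last exact: dom1.
- exact: C1_snd_coord.
- exact: reg.
- exact: C1_fst.
- exact: dom2.
Qed.

Lemma reduced_E2_root : residual (0, 0) = 0.
Proof.
have [v0 v1] := andP k2_bounds.
have vn0 : 1 - k2_minus gP gQ != 0 by rewrite gt_eqF.
rewrite /residual /= reduced_E20// subr0 base_sine_sqrt//; field.
exact: vn0.
Qed.

(** The partial derivative is the ordinary derivative of [reduced_E2] in its first argument at zero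
    perturbation, which [base_is_derive] computes. *)
Lemma diff_residual_gt0 : 0 < 'd residual (0, 0) (1, 0).
Proof.
have [c c0 dc] := base_is_derive margin gQ0 gP0.
have dH : differentiable residual (0, 0).
  exact: (C1_at_differentiable (C1_residual (nbhs_singleton nbhs_admissible))).
have d1 := is_derive_partial1 dH.
have HE : (fun t : R => residual (t, 0)) = _ := funext (reduced_E20 gP gQ b0).
move: d1; rewrite HE => d1.
by rewrite -(@derive_val _ _ _ _ _ _ _ d1) (@derive_val _ _ _ _ _ _ _ dc).
Qed.

(** The corner [(k1 + e1 (y, mu), 1 - k2 - y)] satisfies the bounding equations of
    [power_flow_exists]. The solution found there has [x] between [vE - 1 = - (k2 + y)] and [0],
    which fits the box. *)
Lemma admissible_power_flow (mu : 'rV[R]_4) (y : R) :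
  admissible (y, mu) -> residual (y, mu) = 0 -> 0 <= rho b mu -> 0 <= rho_tilde b mu ->
  exists p, A_minus gP gQ (row2 (e1 (y, mu)) y) p /\
            power_flow_solution b gP gQ mu p.
Proof.
move=> Ap Hy ro0 rt0; have [/= /andP[lo hi] dom2] := admissible_domain Ap.
case: Ap => /= _ reg kg k2y vq.
have k0 : 0 < k_pert b mu.
  have bt := b_tilde_gt0 reg; have [_ _ bh] := reg.
  by apply: divr_gt0; [exact: mulr_gt0|exact: exprn_gt0].
(* The factor [1 + k2 + y] of [rho] becomes [2 - vE]. *)
pose psiE : R := k1 + e1 (y, mu); pose vE : R := 1 - k2 - y.
have [|||||||||||psi [x [pp xx eqp eqx]]] :=
  @power_flow_exists R (k_pert b mu) (rho b mu) (rho_tilde b mu) gP gQ psiE vE.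
- exact: k0.
- exact: ro0.
- exact: rt0.
- exact: ltW.
- exact: gQ0.
- exact: ltW.
- by rewrite /psiE; lra.
- by rewrite /vE; lra.
- exact: ltW.
- by rewrite /psiE /e1 /eps1_of /k1 /k1_minus /vE /k2 /=; ring.
- move: Hy; rewrite /residual /reduced_E2 /= -/(e1 (y, mu)) -/k1 -/k2 -/psiE -/vE.
  by rewrite /vE; lra.
exists (psi, x); split.
  rewrite /A_minus /= !mxE /= -/k1 -/k2 -/psiE.
  by split; rewrite ler_norml; move: pp xx; rewrite /vE; lra.
by rewrite /power_flow_solution /flow_iter /= -eqp -eqx.
Qed.

Lemma two_bus_implicit :
  exists (Ueps : set 'rV[R]_2) (Umu : set 'rV[R]_4),
    [/\ open Ueps, open Umu,
        Ueps `*` Umu `<=` D `*` [set: 'rV[R]_4] &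
        (Ueps `*` Umu) (0, 0)] /\
    exists f : 'rV[R]_4 -> 'rV[R]_2,
      [/\ implicit_solution b gP gQ D Umu f,
          (forall h : 'rV[R]_4 -> 'rV[R]_2,
             implicit_solution b gP gQ D Umu h ->
             forall mu, Umu mu -> h mu = f mu),
          (forall mu, Umu mu ->
             Ueps (f mu) /\
             forall eps, Ueps eps -> (E b gP gQ eps mu = 0 <-> eps = f mu)) &
          (forall mu, Umu mu -> 0 <= rho b mu -> 0 <= rho_tilde b mu ->
             exists p, A_minus gP gQ (f mu) p /\
                       power_flow_solution b gP gQ mu p)].
Proof.
have [r [d [f2 [[r0 d0] loc uniq C1f2]]]] :=
  scalar_implicit_function nbhs_admissible C1_residual reduced_E2_root diff_residual_gt0.
pose f (mu : 'rV[R]_4) := row2 (e1 (f2 mu, mu)) (f2 mu).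
have fr (mu : 'rV[R]_4) : ball 0 d mu -> `|f2 mu| < r by case/loc; rewrite subr0.
have fA (mu : 'rV[R]_4) : ball 0 d mu -> admissible (f2 mu, mu) by case/loc.
have fD (mu : 'rV[R]_4) : ball 0 d mu -> D (f mu) by case/fA.
have fE (mu : 'rV[R]_4) : ball 0 d mu -> E b gP gQ (f mu) mu = 0.
  move=> /loc[_ Hf _]; apply/E_eq0P; rewrite /f !mxE /=.
  by split; [|exact: Hf].
have funiq (eps : 'rV[R]_2) (mu : 'rV[R]_4) : ball 0 d mu -> `|eps 0 1| <= r -> E b gP gQ eps mu = 0 ->
    eps = f mu.
  move=> muB er /E_eq0P[eps0 eps1].
  have E1 : eps 0 1 = f2 mu.
    by apply: uniq; [exact: muB|rewrite subr0|exact: eps1].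
  by rewrite [LHS]row2_eta eps0 E1.
have B0 : ball (0 : 'rV[R]_4) d 0 by exact: ballxx.
have f0 : f 0 = 0.
  apply/esym/funiq => //; first by rewrite mxE normr0 ltW.
  apply/E_eq0P; rewrite !mxE; split; last exact: reduced_E2_root.
  by rewrite eps1_of0// subr0; ring.
have C1f : C1_on (ball 0 d) f.
  apply: C1_on_coord => x xB j.
  have C1fj := C1f2 x xB; have [Df reg _ _ _] := fA x xB.
  have [_ dom2] := admissible_domain (fA x xB).
  have [->|j0] := eqVneq j 0.
    have -> : (fun q => f q 0 0) = (fun q => eps1_of b gP gQ (f2 q) q).
      by apply/funext => q; rewrite /f mxE.
    by apply: (@C1_eps1_of _ _ b gP gQ id x (C1_coord x) reg f2 C1fj).
  have -> : (fun q => f q 0 j) = f2; last exact: C1fj.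
  by apply/funext => q; rewrite /f mxE (negbTE j0).
(* Besides membership in [D], only the second coordinate is bounded: a zero of [E] has its first
   coordinate determined by it through [eps1_of]. *)
exists (D `&` [set eps | `|eps 0 1| < r]), (ball 0 d); split.
  split.
  - apply: openI; first exact: oD.
    apply: (@open_comp _ _ (fun eps : 'rV[R]_2 => `|eps 0 1|) [set x | x < r]);
      last exact: open_lt.
    move=> eps _; apply: (@continuous_comp _ _ _ (fun eps : 'rV[R]_2 => eps 0 1)
      (@Num.norm _ R)); first exact: coord_continuous.
    exact: norm_continuous.
  - exact: ball_open.
  - by move=> p [[]].
  - by split => //; split => //=; rewrite mxE normr0.
exists f; split => //.
- move=> h [C1h h0 hD hE] mu muB.
  have ch x : ball 0 d x -> {for x, continuous (fun q => h q 0 1)}.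
    move=> xB; apply: (@continuous_comp _ _ _ h (fun M : 'rV[R]_2 => M 0 1)).
      by apply: differentiable_continuous; case: (C1h x xB).
    exact: coord_continuous.
  apply: (funiq) => //; last exact: hE.
  apply: ltW; apply: (norm_lt_of_avoids r0 _ muB ch); first by rewrite h0 mxE.
  (* If the second coordinate of [h x] had norm [r], uniqueness up to [r] would give [h x = f x],
     whose second coordinate has norm below [r]. *)
  move=> x xB; apply/eqP => hr.
  have hx : h x = f x by apply: funiq => //; [rewrite hr|exact: hE].
  by have := fr x xB; rewrite -hr hx /f mxE /= ltxx.
- move=> mu muB; split; first by split; [exact: fD|rewrite /= /f mxE; exact: fr].
  move=> eps [_ /= er]; split => [|->]; last exact: fE.
  by apply: funiq => //; exact: ltW.
- move=> mu muB ro0 rt0; apply: admissible_power_flow => //; first exact: fA.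
  by case: (loc mu muB).
Qed.

End two_bus.

Theorem proposition2 (R : realType) (V2 b P1 Q1 : R) (D : set 'rV[R]_2) :
  let gP := loading_margin b V2 P1 in
  let gQ := loading_margin b V2 Q1 in
  let k1 := k1_minus gP gQ in
  let k2 := k2_minus gP gQ in
  0 < V2 -> 0 < b ->
  0 < 4 * gP ^+ 2 - 4 * gQ < 1 ->
  gQ <= 0 -> gP < 0 ->
  open D -> D 0 -> D `<=` E_domain gP gQ ->
  exists (Ueps : set 'rV[R]_2) (Umu : set 'rV[R]_4),
    [/\ open Ueps, open Umu,
        Ueps `*` Umu `<=` D `*` [set: 'rV[R]_4] &
        (Ueps `*` Umu) (0, 0)] /\
    exists f : 'rV[R]_4 -> 'rV[R]_2,
      [/\ implicit_solution b gP gQ D Umu f,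
          (forall h : 'rV[R]_4 -> 'rV[R]_2,
             implicit_solution b gP gQ D Umu h ->
             forall mu, Umu mu -> h mu = f mu),
          (forall mu, Umu mu ->
             Ueps (f mu) /\
             forall eps, Ueps eps ->
               ((- k_pert b mu * gP / (1 - k2 - eps 0 1) + gP / (1 - k2)
                   + rho b mu * (1 + k2 + eps 0 1) + rho_tilde b mu = eps 0 0
                 /\
                 - k_pert b mu * gQ / (1 - k2 - eps 0 1) + (1 - k2)
                   + rho_tilde b mu * (k1 + eps 0 0)
                   - Num.sqrt (1 - (k1 + eps 0 0) ^+ 2) = eps 0 1)
                <-> eps = f mu)) &
          (forall mu, Umu mu -> 0 <= rho b mu -> 0 <= rho_tilde b mu ->
             exists p, A_minus gP gQ (f mu) p /\
                       power_flow_solution b gP gQ mu p)].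
Proof.
move=> gP gQ k1 k2 V20 b0 margin gQ0 gP0 oD D0 DE.
have [Ueps [Umu [opens [f [sol uniq loc flow]]]]] :=
  two_bus_implicit b0 margin gQ0 gP0 oD D0 DE.
exists Ueps, Umu; split; first exact: opens.
exists f; split; [exact: sol|exact: uniq| |exact: flow].
move=> mu muU; have [Uf eqf] := loc mu muU; split; first exact: Uf.
(* [E_eq0P] gives the eliminated form; replacing [eps1_of] by [eps 0 0] recovers the two displayed
   equations. *)
move=> eps Ueps_eps; rewrite -(eqf eps Ueps_eps) E_eq0P.
split=> [[eq1 eq2]|[eq1 eq2]].
  split; first by rewrite -[LHS]eq1.
  apply/eqP; rewrite subr_eq0 eq_sym; apply/eqP.
  by rewrite -[RHS]eq2 -eq1.
split; first by rewrite [RHS]eq1.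
apply/eqP; rewrite eq_sym -subr_eq0; apply/eqP.
by rewrite -[RHS]eq2 /reduced_E2 -eq1.
Qed.
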